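(* Let $0<\rho<1$ and let $(j_N)_{N\ge1}$ be a sequence of integers with $1\le j_N\le N$ and $\frac{j_N}{N}=O\left(\frac1N\right)$ as $N\to\infty$ (that is, $(j_N)$ is bounded). Then, as $N\to\infty$, \[ \sup_{|z|<\rho}\left|S_{N,j_N}(z)-\frac{z}{(1-z)^2}\right|<\frac{2}{(1-\rho)^3}\,\frac1N+o\left(\frac1N\right), \] i.e. there is a real sequence $(\varepsilon_N)$ with $N\varepsilon_N\to0$ such that the left-hand side is less than $\frac{2}{(1-\rho)^3N}+\varepsilon_N$ for all sufficiently large $N$.
   Context: For integers $N\ge 1$ and $1\le j\le N$, the Suffridge polynomial is \[ S_{N,j}(z)= \sum_{k=1}^N \frac{N+1-k}{N}\, \frac{\sin\frac{kj\pi }{N+1}}{\sin\frac{j\pi}{N+1}}\, z^k . \] The function $K(z)=\frac{z}{(1-z)^2}$ is the Koebe function. *)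

(* Defs.v *)
From Stdlib Require Import Reals.
From Coquelicot Require Import Coquelicot.
Open Scope R_scope.

Definition suffridge (N j : nat) (z : C) : C :=
  sum_n_m (fun k : nat =>
    (RtoC ((INR N + 1 - INR k) / INR N *
           (sin (INR k * INR j * PI / (INR N + 1)) /
            sin (INR j * PI / (INR N + 1)))) * z ^ k)%C) 1 N.

Definition koebe (z : C) : C := (z / (1 - z) ^ 2)%C.

(* The supremum is taken in [Rbar], so that an unbounded difference would give
   [p_infty] rather than a junk real value. *)
Definition sup_dist_disk (rho : R) (f g : C -> C) : Rbar :=
  Lub_Rbar (fun r : R => exists z : C, Cmod z < rho /\ r = Cmod (f z - g z)%C).

Definition seq_bigO (u v : nat -> R) : Prop :=
  exists M : R, eventually (fun N : nat => Rabs (u N) <= M * Rabs (v N)).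

(* Main.v *)
(** With [t = j PI / (N + 1)] and [s k = sin (k t) / sin t], the recurrence
    [s (k + 1) = s k * cos t + cos (k t)] gives [|s k| <= k] and
    [|k - s k| <= k^3 t^2 / 2].  As [t = O(1/N)], the [k]-th Suffridge coefficient
    [(N + 1 - k) / N * s k] differs from the Koebe coefficient [k] by at most
    [k (k - 1) / N + O(k^3 / N^2)].  Summing against [rho^k], the first term gives
    [2 rho^2 / (1 - rho)^3 / N]; the second one and the tail of the Koebe series,
    estimated in closed form, give [O(1/N^2)]. *)

Require Import Defs.
From Stdlib Require Import Reals Arith Lra Lia.
From Coquelicot Require Import Coquelicot.
Open Scope R_scope.

(** * Trigonometric estimates for the ratio [sin (k t) / sin t] *)

Lemma cos_ge_quadratic (x : R) : 1 - x ^ 2 / 2 <= cos x.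
Proof.
  assert (H : forall y, 0 <= y -> sin y <= y).
  { intros y Hy. destruct (Req_dec y 0) as [-> | Hn].
    - rewrite sin_0; lra.
    - apply Rlt_le, sin_lt_x; lra. }
  assert (Hs : Rabs (sin (x / 2)) <= Rabs (x / 2)).
  { assert (Hp : forall y, 0 <= y -> Rabs (sin y) <= y).
    { intros y Hy. destruct (Rle_dec y 1) as [H1 | H1].
      - rewrite Rabs_pos_eq; [now apply H |].
        apply sin_ge_0; [easy | generalize PI2_1; lra].
      - apply Rle_trans with 1; [| lra].
        apply Rabs_le. generalize (SIN_bound y); lra. }
    destruct (Rle_dec 0 (x / 2)) as [H0 | H0].
    - rewrite (Rabs_pos_eq (x / 2)) by easy. now apply Hp.
    - rewrite (Rabs_left (x / 2)) by lra.
      rewrite <- Rabs_Ropp, <- sin_neg. apply Hp. lra. }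
  apply Rsqr_le_abs_1 in Hs. unfold Rsqr in Hs.
  replace x with (2 * (x / 2)) at 2 by field.
  rewrite cos_2a_sin. nra.
Qed.

Lemma sin_ratio_S (t : R) (k : nat) (ht : sin t <> 0) :
  sin (INR (S k) * t) / sin t =
  sin (INR k * t) / sin t * cos t + cos (INR k * t).
Proof.
  rewrite S_INR, Rmult_plus_distr_r, Rmult_1_l, sin_plus. now field.
Qed.

(** Each step of the recurrence multiplies the previous ratio by one cosine and adds another, so its
    absolute value grows by at most 1. *)
Lemma sin_ratio_bound (t : R) (k : nat) (ht : sin t <> 0) :
  Rabs (sin (INR k * t) / sin t) <= INR k.
Proof.
  induction k as [| k IH].
  - simpl. rewrite Rmult_0_l, sin_0. unfold Rdiv. rewrite Rmult_0_l, Rabs_R0. lra.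
  - rewrite sin_ratio_S, S_INR by easy.
    eapply Rle_trans; [apply Rabs_triang |].
    apply Rplus_le_compat; [| apply Rabs_le; generalize (COS_bound (INR k * t)); lra].
    rewrite Rabs_mult. rewrite <- (Rmult_1_r (INR k)) at 2.
    apply Rmult_le_compat; try apply Rabs_pos; [easy |].
    apply Rabs_le. generalize (COS_bound t); lra.
Qed.

(** Passing from [k] to [k + 1] adds [s (1 - cos t) + (1 - cos (k t))] to the defect [k - s]. By
    [sin_ratio_bound] and the quadratic cosine bound, these terms cost at most [k t^2 / 2] and
    [k^2 t^2 / 2]. *)
Lemma sin_ratio_near (t : R) (k : nat) (ht : sin t <> 0) :
  Rabs (INR k - sin (INR k * t) / sin t) <= INR k ^ 3 * (t ^ 2 / 2).
Proof.
  induction k as [| k IH].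
  - simpl. rewrite Rmult_0_l, sin_0. unfold Rdiv. rewrite Rmult_0_l, Rminus_0_r, Rabs_R0. lra.
  - rewrite sin_ratio_S, S_INR by easy.
    generalize (sin_ratio_bound t k ht); intros Hb.
    generalize (cos_ge_quadratic t) (COS_bound t)
      (cos_ge_quadratic (INR k * t)) (COS_bound (INR k * t)) (pos_INR k).
    set (s := sin (INR k * t) / sin t) in *. set (x := INR k) in *.
    set (c := cos t). set (d := cos (x * t)). intros Hc Hc1 Hd Hd1 Hx.
    assert (H1 : Rabs (s * (1 - c)) <= x * (t ^ 2 / 2)).
    { rewrite Rabs_mult. apply Rmult_le_compat; try apply Rabs_pos; [easy |].
      rewrite Rabs_pos_eq; lra. }
    assert (H2 : Rabs (1 - d) <= x ^ 2 * (t ^ 2 / 2)).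
    { rewrite Rabs_pos_eq by lra. nra. }
    replace (x + 1 - (s * c + d)) with ((x - s) + (s * (1 - c) + (1 - d))) by ring.
    eapply Rle_trans; [apply Rabs_triang |].
    eapply Rle_trans; [apply Rplus_le_compat; [exact IH | apply Rabs_triang] |].
    (* The induction closes because [x^3 + x^2 + x <= (x + 1)^3] for [x >= 0]. *)
    assert (0 <= t ^ 2 / 2) by nra. nra.
Qed.

Lemma suffridge_coef_near (N k : nat) (t : R) (hN : (1 <= N)%nat) (hk : (1 <= k)%nat)
  (ht : sin t <> 0) :
  Rabs ((INR N + 1 - INR k) / INR N * (sin (INR k * t) / sin t) - INR k) <=
  INR k * (INR k - 1) / INR N + INR k ^ 3 * (t ^ 2 / 2).
Proof.
  apply le_INR in hN, hk. simpl in hN, hk.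
  generalize (sin_ratio_bound t k ht) (sin_ratio_near t k ht).
  set (s := sin (INR k * t) / sin t). set (x := INR k) in *. set (n := INR N) in *.
  intros Hb Hn.
  (* The weight differs from 1 by [(x - 1) / n]: this separates the error of the weight, of order
     [1 / N], from the error of the sine ratio. *)
  replace ((n + 1 - x) / n * s - x) with (- (s * ((x - 1) / n)) + - (x - s)) by (field; lra).
  eapply Rle_trans; [apply Rabs_triang |]. rewrite !Rabs_Ropp.
  apply Rplus_le_compat; [| easy].
  assert (0 <= (x - 1) / n) by (apply Rdiv_le_0_compat; lra).
  rewrite Rabs_mult, (Rabs_pos_eq ((x - 1) / n)) by easy.
  unfold Rdiv. rewrite Rmult_assoc. now apply Rmult_le_compat_r.
Qed.

(** * Power sums with polynomial weights *)

(* The subtracted term is the tail [sum_(k > n) k (k - 1) x^k]. *)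
Lemma sum_second_moment (x : R) (n : nat) (hx : x <> 1) :
  sum_n_m (fun k => INR k * (INR k - 1) * x ^ k) 1 n =
  2 * x ^ 2 / (1 - x) ^ 3 -
  x ^ S n * (INR n * (INR n + 1) / (1 - x) + 2 * (INR n + 1) * x / (1 - x) ^ 2 +
             2 * x ^ 2 / (1 - x) ^ 3).
Proof.
  induction n as [| n IH].
  - rewrite sum_n_m_zero by lia. unfold zero; simpl. field. lra.
  - rewrite sum_n_Sm by lia. change (@plus R_AbelianMonoid) with Rplus.
    rewrite IH, S_INR. simpl. field. lra.
Qed.

Lemma sum_second_moment_le (x : R) (n : nat) (hx : 0 <= x < 1) :
  sum_n_m (fun k => INR k * (INR k - 1) * x ^ k) 1 n <= 2 * x ^ 2 / (1 - x) ^ 3.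
Proof.
  rewrite sum_second_moment by lra.
  generalize (pos_INR n); intros Hn.
  assert (0 <= x ^ S n) by (apply pow_le; lra).
  assert (0 < (1 - x) ^ 2) by (apply pow_lt; lra).
  assert (0 < (1 - x) ^ 3) by (apply pow_lt; lra).
  assert (0 <= INR n * (INR n + 1) / (1 - x)) by (apply Rdiv_le_0_compat; nra).
  assert (0 <= 2 * (INR n + 1) * x / (1 - x) ^ 2) by (apply Rdiv_le_0_compat; nra).
  assert (0 <= 2 * x ^ 2 / (1 - x) ^ 3) by (apply Rdiv_le_0_compat; nra).
  nra.
Qed.

Lemma ex_series_cube_geom (x : R) (hx : 0 < x < 1) :
  ex_series (fun k => INR k ^ 3 * x ^ k).
Proof.
  (* The term at 0 vanishes, while the ratio test needs nonzero terms; hence the shift to [S k]. *)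
  apply ex_series_incr_1.
  apply ex_series_ext with (fun k => Rabs (INR (S k) ^ 3 * x ^ S k)).
  { intros k. apply Rabs_pos_eq, Rmult_le_pos; apply pow_le; [apply pos_INR | lra]. }
  apply ex_series_DAlembert with x; [lra | |].
  - intros n. apply Rmult_integral_contrapositive_currified; apply pow_nonzero;
      [apply not_0_INR; lia | lra].
  - apply is_lim_seq_ext with
      (fun n => (1 + / INR (S n)) * ((1 + / INR (S n)) * ((1 + / INR (S n)) * x))).
    + intros n. assert (0 < INR (S n)) by (apply lt_0_INR; lia).
      assert (0 < / INR (S n)) by now apply Rinv_0_lt_compat.
      rewrite (S_INR (S n)).
      assert (x ^ n <> 0) by (apply pow_nonzero; lra).
      set (y := INR (S n)) in *.
      replace ((y + 1) ^ 3 * x ^ S (S n) / (y ^ 3 * x ^ S n))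
        with ((1 + / y) * ((1 + / y) * ((1 + / y) * x)))
        by (simpl; field; repeat split; lra).
      symmetry; apply Rabs_pos_eq.
      repeat apply Rmult_le_pos; lra.
    + assert (Hl : is_lim_seq (fun n => 1 + / INR (S n)) 1).
      { replace (Finite 1) with (Finite (1 + 0)) by (f_equal; ring).
        apply is_lim_seq_plus'; [apply is_lim_seq_const |].
        apply (is_lim_seq_incr_1 (fun n => / INR n)).
        apply (is_lim_seq_inv INR p_infty is_lim_seq_INR). discriminate. }
      replace (Finite x) with (Finite (1 * (1 * (1 * x)))) by (f_equal; ring).
      repeat (apply is_lim_seq_mult'; [exact Hl |]). apply is_lim_seq_const.
Qed.

(** Arbitrary bounds [m] and [n] let it serve both for whole partial sums and for a single term,
    [m = n]. *)
Lemma sum_n_m_le_Series (a : nat -> R) (m n : nat)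
  (ha : forall k, 0 <= a k) (hs : ex_series a) : sum_n_m a m n <= Series a.
Proof.
  assert (h0 : forall p q, 0 <= sum_n_m a p q).
  { intros p q. apply Rle_trans with (sum_n_m (fun _ => zero) p q).
    - rewrite sum_n_m_const_zero. apply Rle_refl.
    - apply sum_n_m_le. exact ha. }
  apply Rle_trans with (sum_n a n).
  - unfold sum_n. destruct m as [| m]; [apply Rle_refl |].
    destruct (Nat.le_gt_cases (S m) n) as [H | H].
    + rewrite (sum_n_m_Chasles a 0 m n) by lia.
      rewrite <- (Rplus_0_l (sum_n_m a (S m) n)) at 1.
      apply Rplus_le_compat; [apply h0 | apply Rle_refl].
    + rewrite sum_n_m_zero by lia. apply h0.
  - apply (is_lim_seq_incr_compare (sum_n a)).
    + exact (Series_correct a hs).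
    + intros k. rewrite sum_Sn. unfold plus; simpl. generalize (ha (S k)); lra.
Qed.

(** * The tail of the Koebe series *)

Lemma Cone_minus_neq_0 (z : C) (hz : Cmod z < 1) : (1 - z)%C <> 0%C.
Proof.
  intros H. assert (z = 1%C) as ->.
  { replace z with (1 - (1 - z))%C by ring. rewrite H. ring. }
  rewrite Cmod_1 in hz. lra.
Qed.

(** An exact identity by induction on [n], starting from [koebe z] itself at [n = 0]; no infinite
    complex series enters. *)
Lemma koebe_tail (z : C) (n : nat) (hz : (1 - z)%C <> 0%C) :
  (koebe z - sum_n_m (fun k => RtoC (INR k) * z ^ k) 1 n)%C =
  (z ^ S n * (INR n + 1 - INR n * z) / (1 - z) ^ 2)%C.
Proof.
  induction n as [| n IH].
  - rewrite sum_n_m_zero by lia. unfold koebe, zero; simpl. field. exact hz.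
  - rewrite sum_n_Sm by lia. change (@plus C_AbelianMonoid) with Cplus.
    replace (koebe z - (sum_n_m (fun k => RtoC (INR k) * z ^ k) 1 n +
                        RtoC (INR (S n)) * z ^ S n))%C
      with ((koebe z - sum_n_m (fun k => RtoC (INR k) * z ^ k) 1 n) -
            RtoC (INR (S n)) * z ^ S n)%C by ring.
    rewrite IH, S_INR, RtoC_plus. simpl. field. exact hz.
Qed.

(** In the closed form, [|n + 1 - n z| <= 2 n + 1] and [|1 - z| >= 1 - rho]. *)
Lemma Cmod_koebe_tail_le (rho : R) (z : C) (n : nat) (hrho : rho < 1) (hz : Cmod z < rho) :
  Cmod (koebe z - sum_n_m (fun k => RtoC (INR k) * z ^ k)%C 1 n)%C <=
  rho ^ S n * (2 * INR n + 1) / (1 - rho) ^ 2.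
Proof.
  generalize (Cmod_ge_0 z) (pos_INR n); intros H0 Hn.
  assert (Hz : (1 - z)%C <> 0%C) by (apply Cone_minus_neq_0; lra).
  rewrite koebe_tail, Cmod_div, Cmod_mult, !Cmod_pow by (try apply Cpow_nz; exact Hz).
  assert (H1 : 1 - rho <= Cmod (1 - z)).
  { generalize (Cmod_triangle (1 - z) z).
    replace (1 - z + z)%C with (RtoC 1) by ring. rewrite Cmod_1. lra. }
  assert (0 < (1 - rho) ^ 2) by (apply pow_lt; lra).
  apply Rmult_le_compat.
  - apply Rmult_le_pos; [now apply pow_le | apply Cmod_ge_0].
  - apply Rlt_le, Rinv_0_lt_compat, pow_lt; lra.
  - apply Rmult_le_compat; [now apply pow_le | apply Cmod_ge_0 | apply pow_incr; lra |].
    unfold Cminus. eapply Rle_trans; [apply Cmod_triangle |].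
    rewrite Cmod_opp, Cmod_mult, <- RtoC_plus, !Cmod_R, !Rabs_pos_eq by lra.
    nra.
  - apply Rinv_le_contravar; [easy | apply pow_incr; lra].
Qed.

(** * Suffridge polynomials against truncations of the Koebe series *)

Lemma Cmod_sum_n_m_le (u : nat -> C) (b : nat -> R) (m n : nat)
  (h : forall k, (m <= k <= n)%nat -> Cmod (u k) <= b k) :
  Cmod (sum_n_m u m n) <= sum_n_m b m n.
Proof.
  induction n as [| n IH].
  - destruct m as [| m].
    + rewrite !sum_n_n. apply h. lia.
    + rewrite !sum_n_m_zero by lia. unfold zero; simpl. rewrite Cmod_0. lra.
  - destruct (Nat.le_gt_cases m (S n)) as [H | H].
    + rewrite !sum_n_Sm by lia.
      change (@plus C_AbelianMonoid) with Cplus. change (@plus R_AbelianMonoid) with Rplus.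
      eapply Rle_trans; [apply Cmod_triangle |].
      apply Rplus_le_compat; [apply IH; intros; apply h; lia | apply h; lia].
    + rewrite !sum_n_m_zero by lia. unfold zero; simpl. rewrite Cmod_0. lra.
Qed.

Lemma suffridge_minus_monomials_le (rho t : R) (N j : nat) (z : C)
  (hN : (1 <= N)%nat) (hj : (1 <= j <= N)%nat)
  (hrho : 0 < rho < 1) (hz : Cmod z < rho)
  (ht : t = INR j * PI / (INR N + 1)) :
  Cmod (suffridge N j z - sum_n_m (fun k => RtoC (INR k) * z ^ k)%C 1 N)%C <=
  / INR N * (2 * rho ^ 2 / (1 - rho) ^ 3) +
  t ^ 2 / 2 * Series (fun k => INR k ^ 3 * rho ^ k).
Proof.
  assert (HN : 1 <= INR N) by (apply (le_INR 1); lia).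
  assert (Hj : 1 <= INR j) by (apply (le_INR 1); lia).
  assert (HjN : INR j <= INR N) by (apply le_INR; lia).
  generalize PI_RGT_0; intros HPI.
  assert (Ht0 : 0 < t).
  { rewrite ht. apply Rdiv_lt_0_compat; nra. }
  assert (HtPI : t < PI).
  { rewrite ht. apply Rmult_lt_reg_r with (INR N + 1); [lra |].
    unfold Rdiv. rewrite Rmult_assoc, Rinv_l by lra. nra. }
  (* From [1 <= j <= N] the angle lies strictly between 0 and [PI], so the denominator [sin t] is
     positive. *)
  assert (Hs : sin t <> 0) by (apply Rgt_not_eq, sin_gt_0; lra).
  set (c := fun k => (INR N + 1 - INR k) / INR N * (sin (INR k * t) / sin t)).
  assert (E : suffridge N j z =
    (sum_n_m (fun k => RtoC (c k - INR k) * z ^ k) 1 N +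
     sum_n_m (fun k => RtoC (INR k) * z ^ k) 1 N)%C).
  { unfold suffridge.
    rewrite <- (sum_n_m_plus (G := C_AbelianMonoid)).
    apply sum_n_m_ext. intros k. unfold plus; simpl. unfold c.
    replace (INR k * t) with (INR k * INR j * PI / (INR N + 1)) by (rewrite ht; field; lra).
    rewrite <- ht, RtoC_minus. ring. }
  assert (add_sub : forall a b : C, (a + b - b)%C = a) by (intros; ring).
  rewrite E, add_sub.
  eapply Rle_trans.
  (* The two parts of the coefficient bound stay separate, so that the [1 / N] part keeps its sharp
     constant. *)
  { apply Cmod_sum_n_m_le with (b := fun k =>
      plus (mult (/ INR N) (INR k * (INR k - 1) * rho ^ k))
           (mult (t ^ 2 / 2) (INR k ^ 3 * rho ^ k))).
    intros k Hk. rewrite Cmod_mult, Cmod_R, Cmod_pow.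
    generalize (suffridge_coef_near N k t hN (proj1 Hk) Hs); intros Hc.
    eapply Rle_trans.
    { apply Rmult_le_compat; [apply Rabs_pos | apply pow_le, Cmod_ge_0 | exact Hc |].
      apply pow_incr. split; [apply Cmod_ge_0 | apply Rlt_le, hz]. }
    unfold plus, mult; simpl. right. field. lra. }
  rewrite sum_n_m_plus, !(sum_n_m_mult_l (K := R_Ring)). unfold plus, mult; simpl.
  apply Rplus_le_compat; apply Rmult_le_compat_l.
  - apply Rlt_le, Rinv_0_lt_compat; lra.
  - apply sum_second_moment_le; lra.
  - nra.
  - apply (sum_n_m_le_Series (fun k => INR k ^ 3 * rho ^ k)).
    + intros k. apply Rmult_le_pos; apply pow_le; [apply pos_INR | lra].
    + now apply ex_series_cube_geom.
Qed.

(** The single term of index [N + 1] is at most the whole series, and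
    [(2 N + 1) N^2 <= 2 (N + 1)^3]. *)
Lemma geom_tail_le_inv_sq (rho : R) (N : nat) (hN : (1 <= N)%nat) (hrho : 0 < rho < 1) :
  rho ^ S N * (2 * INR N + 1) <=
  2 * Series (fun k => INR k ^ 3 * rho ^ k) / INR N ^ 2.
Proof.
  assert (HN : 1 <= INR N) by (apply (le_INR 1); lia).
  assert (H : INR (S N) ^ 3 * rho ^ S N <= Series (fun k => INR k ^ 3 * rho ^ k)).
  { rewrite <- (sum_n_n (G := R_AbelianMonoid) (fun k => INR k ^ 3 * rho ^ k)).
    apply sum_n_m_le_Series; [| now apply ex_series_cube_geom].
    intros k. apply Rmult_le_pos; apply pow_le; [apply pos_INR | lra]. }
  rewrite S_INR in H.
  assert (0 < rho ^ S N) by (apply pow_lt; lra).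
  assert (H1 : 0 < INR N ^ 2) by (apply pow_lt; lra).
  apply (proj1 (Rle_div_r _ _ _ H1)).
  apply Rle_trans with (2 * ((INR N + 1) ^ 3 * rho ^ S N)); [| lra].
  replace (rho ^ S N * (2 * INR N + 1) * INR N ^ 2)
    with (rho ^ S N * ((2 * INR N + 1) * INR N ^ 2)) by ring.
  replace (2 * ((INR N + 1) ^ 3 * rho ^ S N))
    with (rho ^ S N * (2 * (INR N + 1) ^ 3)) by ring.
  apply Rmult_le_compat_l; nra.
Qed.

(** * From pointwise bounds to the asymptotic estimate of the supremum *)

Lemma sup_dist_disk_le (rho B : R) (f g : C -> C)
  (h : forall z, Cmod z < rho -> Cmod (f z - g z)%C <= B) :
  Rbar_le (sup_dist_disk rho f g) B.
Proof.
  apply (proj2 (Lub_Rbar_correct _)).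
  intros r [z [Hz ->]]. now apply h.
Qed.

Theorem mainTheorem4 (rho : R) (j : nat -> nat)
  (hrho : 0 < rho < 1)
  (hj : forall N : nat, (1 <= N)%nat -> (1 <= j N <= N)%nat)
  (hO : seq_bigO (fun N => INR (j N) / INR N) (fun N => 1 / INR N)) :
  exists eps : nat -> R,
    is_lim_seq (fun N => INR N * eps N) 0 /\
    eventually (fun N : nat =>
      Rbar_lt (sup_dist_disk rho (suffridge N (j N)) koebe)
              (Finite (2 / (1 - rho) ^ 3 * (1 / INR N) + eps N))).
Proof.
  destruct hO as [M [N0 HM]].
  set (B := Series (fun k => INR k ^ 3 * rho ^ k)).
  assert (HB : 0 <= B).
  { generalize (sum_n_m_le_Series (fun k => INR k ^ 3 * rho ^ k) 0 0).
    rewrite sum_n_n. simpl. intros H. eapply Rle_trans; [| apply H].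
    - lra.
    - intros k. apply Rmult_le_pos; [| apply pow_le; lra].
      apply (pow_le _ 3), pos_INR.
    - now apply (ex_series_cube_geom rho). }
  (* The first summand collects the [t^2 / 2] error, using [t <= M PI / N]; the second comes from
     the Koebe tail. *)
  set (A := M ^ 2 * PI ^ 2 / 2 * B + 2 * B / (1 - rho) ^ 2).
  exists (fun N => A / INR N ^ 2). split.
  - apply is_lim_seq_ext_loc with (fun N => A * / INR N).
    { exists 1%nat. intros N HN. apply (le_INR 1) in HN. simpl in HN.
      simpl. field. lra. }
    replace (Finite 0) with (Rbar_mult A 0) by (simpl; f_equal; ring).
    apply is_lim_seq_scal_l.
    apply (is_lim_seq_inv INR p_infty is_lim_seq_INR). discriminate.
  (* Taking [S N0] ensures [N >= 1] together with [N >= N0]. *)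
  - exists (S N0). intros N HN.
    assert (HN1 : (1 <= N)%nat) by lia.
    assert (HNR : 1 <= INR N) by (apply (le_INR 1); lia).
    specialize (hj N HN1). specialize (HM N ltac:(lia)).
    assert (HjM : INR (j N) <= M).
    { rewrite !Rabs_pos_eq in HM
        by (apply Rdiv_le_0_compat; [try apply pos_INR; lra | lra]).
      apply Rmult_le_reg_r with (/ INR N); [apply Rinv_0_lt_compat; lra |].
      unfold Rdiv in HM. lra. }
    assert (Hj0 : 1 <= INR (j N)) by (apply (le_INR 1); lia).
    set (t := INR (j N) * PI / (INR N + 1)).
    generalize PI_RGT_0; intros HPI.
    assert (Ht : t ^ 2 <= M ^ 2 * PI ^ 2 / INR N ^ 2).
    { replace (M ^ 2 * PI ^ 2 / INR N ^ 2) with ((M * PI / INR N) ^ 2) by (field; lra).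
      apply pow_incr. split.
      - apply Rdiv_le_0_compat; nra.
      - apply Rmult_le_compat; [nra | apply Rlt_le, Rinv_0_lt_compat; lra | nra |].
        apply Rinv_le_contravar; lra. }
    (* Pointwise bounds only give a non-strict inequality for the supremum; strictness comes from
       the spare factor [rho^2 < 1] in the main term. *)
    apply Rbar_le_lt_trans with
      (Finite (/ INR N * (2 * rho ^ 2 / (1 - rho) ^ 3) + A / INR N ^ 2)).
    + apply sup_dist_disk_le. intros z Hz.
      set (P := sum_n_m (fun k => RtoC (INR k) * z ^ k)%C 1 N).
      replace (suffridge N (j N) z - koebe z)%C
        with ((suffridge N (j N) z - P) + - (koebe z - P))%C by ring.
      eapply Rle_trans; [apply Cmod_triangle |]. rewrite Cmod_opp.
      generalize (suffridge_minus_monomials_le rho t N (j N) z HN1 hj hrho Hz eq_refl).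
      generalize (Cmod_koebe_tail_le rho z N (proj2 hrho) Hz).
      generalize (geom_tail_le_inv_sq rho N HN1 hrho).
      fold P B. intros H1 H2 H3.
      assert (H4 : rho ^ S N * (2 * INR N + 1) / (1 - rho) ^ 2 <=
                   2 * B / INR N ^ 2 / (1 - rho) ^ 2).
      { apply Rmult_le_compat_r; [| exact H1].
        apply Rlt_le, Rinv_0_lt_compat, pow_lt. lra. }
      assert (H5 : t ^ 2 / 2 * B <= M ^ 2 * PI ^ 2 / INR N ^ 2 / 2 * B)
        by (apply Rmult_le_compat_r; lra).
      replace (A / INR N ^ 2) with
        (M ^ 2 * PI ^ 2 / INR N ^ 2 / 2 * B + 2 * B / INR N ^ 2 / (1 - rho) ^ 2)
        by (unfold A; field; lra).
      lra.
    + apply (Rplus_lt_compat_r (A / INR N ^ 2)).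
      assert (H : 0 < / INR N * (2 / (1 - rho) ^ 3)).
      { apply Rmult_lt_0_compat; [apply Rinv_0_lt_compat; lra |].
        apply Rdiv_lt_0_compat; [lra | apply pow_lt; lra]. }
      replace (/ INR N * (2 * rho ^ 2 / (1 - rho) ^ 3))
        with (rho ^ 2 * (/ INR N * (2 / (1 - rho) ^ 3))) by (field; lra).
      replace (2 / (1 - rho) ^ 3 * (1 / INR N))
        with (1 * (/ INR N * (2 / (1 - rho) ^ 3))) by (field; lra).
      apply Rmult_lt_compat_r; [exact H | nra].
Qed.
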